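(* Let $\mathbb{D}\in\{\mathbb{R},\mathbb{C},\mathbb{H}\}$ and let $\sigma$ be a Kubo-Ando mean on $\mathscr{P}_2(\mathbb{D})$ with representing function $f:(0,\infty)\to(0,\infty)$. For all $A,B\in\mathscr{P}_2(\mathbb{D})$, let $X:=A^{-1/2}BA^{-1/2}$. Then there exist unique scalars $\alpha_f(X),\beta_f(X)\in\mathbb{R}$ such that $$A\,\sigma\,B=\alpha_f(X)A+\beta_f(X)B.$$ More precisely, if $\lambda_+,\lambda_-$ are the eigenvalues of $X$, then $$\alpha_f(X)=\begin{cases}\dfrac{\lambda_+f(\lambda_-)-\lambda_-f(\lambda_+)}{\lambda_+-\lambda_-}&\text{if }\lambda_+\neq\lambda_-,\\ f(\lambda_+)&\text{otherwise,}\end{cases}\qquad \beta_f(X)=\begin{cases}\dfrac{f(\lambda_+)-f(\lambda_-)}{\lambda_+-\lambda_-}&\text{if }\lambda_+\neq\lambda_-,\\ 0&\text{otherwise.}\end{cases}$$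
   Context: For $\mathbb{D}\in\{\mathbb{R},\mathbb{C},\mathbb{H}\}$, $A^*$ is the conjugate transpose of $A\in\mathrm{Mat}_n(\mathbb{D})$. $\mathscr{P}_n(\mathbb{D})$ is the set of $A\in\mathrm{Mat}_n(\mathbb{D})$ with $A=A^*$ and $x^*Ax>0$ for all nonzero $x\in\mathbb{D}^n$. The Loewner order on $\mathscr{P}_n(\mathbb{D})$ is $A\preceq B$ iff $B-A$ is Hermitian with $x^*(B-A)x\ge0$ for all $x\in\mathbb{D}^n$. Every $X\in\mathscr{P}_n(\mathbb{D})$ can be written $X=U\,\mathrm{diag}(\lambda_1,\dots,\lambda_n)\,U^*$ with $\lambda_i>0$ real and $U\in\mathrm{GL}_n(\mathbb{D})$, $UU^*=\mathrm{Id}_n$; the $\lambda_i$ are the eigenvalues of $X$ (right eigenvalues if $\mathbb{D}=\mathbb{H}$), listed with multiplicity. For $f:(0,+\infty)\to(0,+\infty)$ set $f(X)=U\,\mathrm{diag}(f(\lambda_1),\dots,f(\lambda_n))\,U^*$; real powers $X^t$ are defined in the same way. The function $f$ is operator monotone if for every $k\ge1$ and all $A\preceq B$ in $\mathscr{P}_k(\mathbb{C})$ one has $f(A)\preceq f(B)$. A Kubo-Ando mean on $\mathscr{P}_n(\mathbb{D})$ is a continuous map $\sigma:\mathscr{P}_n(\mathbb{D})\times\mathscr{P}_n(\mathbb{D})\to\mathscr{P}_n(\mathbb{D})$ such that: (1) $A\preceq B$ and $C\preceq D$ imply $A\,\sigma\,C\preceq B\,\sigma\,D$; (2) $g(A\,\sigma\,B)g^*=(gAg^*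 )\,\sigma\,(gBg^* )$ for all $g\in\mathrm{GL}_n(\mathbb{D})$ and $A,B\in\mathscr{P}_n(\mathbb{D})$; (3) $\mathrm{Id}_n\,\sigma\,\mathrm{Id}_n=\mathrm{Id}_n$. The representing function of $\sigma$ is the operator monotone function $f:(0,+\infty)\to(0,+\infty)$ with $f(1)=1$ such that $A\,\sigma\,B=A^{1/2}f(A^{-1/2}BA^{-1/2})A^{1/2}$ for all $A,B\in\mathscr{P}_n(\mathbb{D})$.
   Formalization: When the two eigenvalues of X coincide, B is a multiple of A and the scalars are never unique (e.g. A = B gives (1,0) and (0,1)); uniqueness is therefore stated there only among pairs with β = 0, and in full when λ₊ ≠ λ₋. *)

(* Defs.v *)
From HB Require Import structures.
From mathcomp Require Import all_boot all_order all_algebra.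
From mathcomp Require Import complex ring.
From mathcomp Require Import all_classical reals topology normedtype exp.

Set Implicit Arguments.
Unset Strict Implicit.
Unset Printing Implicit Defensive.

Import Order.TTheory GRing.Theory Num.Theory.
Import numFieldNormedType.Exports.

Local Open Scope classical_set_scope.
Local Open Scope ring_scope.

(* A topological ring-with-conjugation over [R], with an embedding of [R] as   *)
(* the self-conjugate elements.  Its instances are [R], [R[i]] and the         *)
(* quaternions.                                                                *)
HB.mixin Record isStarDivision (R : realType) D
    of GRing.NzRing D & Topological D := {
  inR : R -> D;
  sconj : D -> D;
  inR_is_additive : forall a b, inR (a - b) = inR a - inR b;
  inR1 : inR 1 = 1;
  inRM : forall a b, inR (a * b) = inR a * inR b;
  inRC : forall a z, inR a * z = z * inR a;
  sconjB : forall y z, sconj (y - z) = sconj y - sconj z;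
  sconjM : forall y z, sconj (y * z) = sconj z * sconj y;
  sconjK : involutive sconj;
  sconj_inR : forall a, sconj (inR a) = inR a;
  sconj_fixed : forall z, sconj z = z -> exists a, z = inR a;
  sconj_normP : forall z, z != 0 -> exists2 a, 0 < a & sconj z * z = inR a
}.

#[short(type="starDivisionType")]
HB.structure Definition StarDivision (R : realType) :=
  { D of GRing.NzRing D & Topological D & isStarDivision R D }.

Arguments inR {R D} a : rename.
Arguments sconj {R D} z : rename.

Section RealInstance.
Variable R : realType.

Lemma real_sconj_normP (z : R) :
  z != 0 -> exists2 a : R, 0 < a & z * z = a.
Proof. by move=> z0; exists (z * z) => //; rewrite -expr2 exprn_even_gt0. Qed.

HB.instance Definition _ := @isStarDivision.Build R R idfun idfun
  (fun _ _ => erefl) erefl (fun _ _ => erefl) (@mulrC R)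
  (fun _ _ => erefl) (@mulrC R) (fun _ => erefl) (fun _ => erefl)
  (fun z _ => ex_intro _ z erefl) real_sconj_normP.

End RealInstance.

(* [R[i]] carries the topology of its modulus. *)
HB.instance Definition _ (R : realType) := Topological.copy R[i] (R[i]^o).

Section ComplexInstance.
Variable R : realType.
Local Open Scope complex_scope.

Lemma complex_inRC (a : R) (z : R[i]) : a%:C * z = z * a%:C.
Proof. exact: mulrC. Qed.

Lemma complex_sconjM (y z : R[i]) : (y * z)^* = z^* * y^*.
Proof. by rewrite rmorphM mulrC. Qed.

Lemma complex_sconj_inR (a : R) : (a%:C)^* = a%:C.
Proof. by rewrite /= oppr0. Qed.

Lemma complex_sconj_fixed (z : R[i]) : z^* = z -> exists a : R, z = a%:C.
Proof.
case: z => a b /= [] /eqP; rewrite eq_sym -addr_eq0 -mulr2n mulrn_eq0 /=.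
by move=> /eqP->; exists a.
Qed.

Lemma complex_sconj_normP (z : R[i]) :
  z != 0 -> exists2 a : R, 0 < a & z^* * z = a%:C.
Proof.
case: z => a b; rewrite eq_complex /= => ab0.
exists (a ^+ 2 + b ^+ 2); last by apply/eqP; rewrite eq_complex /=;
  apply/andP; split; apply/eqP; ring.
rewrite lt0r addr_ge0 ?sqr_ge0// andbT paddr_eq0 ?sqr_ge0//.
by rewrite !sqrf_eq0.
Qed.

HB.instance Definition _ := @isStarDivision.Build R R[i]
  (fun a => a%:C) (fun z => z^*)
  (rmorphB (real_complex R)) (rmorph1 (real_complex R))
  (rmorphM (real_complex R)) complex_inRC
  (rmorphB (@conjc R)) complex_sconjM (@conjcK R)
  complex_sconj_inR complex_sconj_fixed complex_sconj_normP.

End ComplexInstance.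

(* [Quat a b c d] is a + b i + c j + d k, with i j = k. *)
Record quaternion (R : Type) := Quat { qre : R; qi : R; qj : R; qk : R }.

Definition quat_coords (R : Type) (x : quaternion R) : R * R * R * R :=
  (qre x, qi x, qj x, qk x).
Definition quat_of_coords (R : Type) (p : R * R * R * R) : quaternion R :=
  Quat p.1.1.1 p.1.1.2 p.1.2 p.2.

Lemma quat_coordsK (R : Type) :
  cancel (@quat_coords R) (@quat_of_coords R).
Proof. by case. Qed.

HB.instance Definition _ (R : choiceType) :=
  Choice.copy (quaternion R) (can_type (@quat_coordsK R)).

Section QuaternionRing.
Variable R : realType.
Implicit Types x y z : quaternion R.

Definition addq x y :=
  Quat (qre x + qre y) (qi x + qi y) (qj x + qj y) (qk x + qk y).
Definition oppq x := Quat (- qre x) (- qi x) (- qj x) (- qk x).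
Definition realq (a : R) : quaternion R := Quat a 0 0 0.
Definition mulq x y :=
  Quat (qre x * qre y - qi x * qi y - qj x * qj y - qk x * qk y)
       (qre x * qi y + qi x * qre y + qj x * qk y - qk x * qj y)
       (qre x * qj y - qi x * qk y + qj x * qre y + qk x * qi y)
       (qre x * qk y + qi x * qj y - qj x * qi y + qk x * qre y).
Definition conjq x := Quat (qre x) (- qi x) (- qj x) (- qk x).

Lemma addqA : associative addq.
Proof. by move=> x y z; congr Quat; apply: addrA. Qed.
Lemma addqC : commutative addq.
Proof. by move=> x y; congr Quat; apply: addrC. Qed.
Lemma add0q : left_id (realq 0) addq.
Proof. by case=> a b c d; congr Quat; apply: add0r. Qed.
Lemma addNq : left_inverse (realq 0) oppq addq.
Proof. by move=> x; congr Quat; apply: addNr. Qed.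

HB.instance Definition _ :=
  GRing.isZmodule.Build (quaternion R) addqA addqC add0q addNq.

Lemma mulqA : associative mulq.
Proof. by move=> x y z; congr Quat => /=; ring. Qed.
Lemma mul1q : left_id (realq 1) mulq.
Proof. by case=> a b c d; congr Quat => /=; ring. Qed.
Lemma mulq1 : right_id (realq 1) mulq.
Proof. by case=> a b c d; congr Quat => /=; ring. Qed.
Lemma mulqDl : left_distributive mulq addq.
Proof. by move=> x y z; congr Quat => /=; ring. Qed.
Lemma mulqDr : right_distributive mulq addq.
Proof. by move=> x y z; congr Quat => /=; ring. Qed.
Lemma oneq_neq0 : realq 1 != 0 :> quaternion R.
Proof. by apply/eqP => -[] /eqP; rewrite oner_eq0. Qed.

HB.instance Definition _ := GRing.Zmodule_isNzRing.Build (quaternion R)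
  mulqA mul1q mulq1 mulqDl mulqDr oneq_neq0.

End QuaternionRing.

(* The topology of the four real coordinates. *)
HB.instance Definition _ (R : realType) :=
  Topological.copy (quaternion R) (initial_topology (@quat_coords R)).

Section QuaternionInstance.
Variable R : realType.
Implicit Types (a b : R) (y z : quaternion R).

Lemma realqB a b : realq (a - b) = realq a - realq b.
Proof. by congr Quat => /=; ring. Qed.
Lemma realqM a b : realq (a * b) = realq a * realq b.
Proof. by congr Quat => /=; ring. Qed.
Lemma realqC a z : realq a * z = z * realq a.
Proof. by congr Quat => /=; ring. Qed.
Lemma conjqB y z : conjq (y - z) = conjq y - conjq z.
Proof. by congr Quat => /=; ring. Qed.
Lemma conjqM y z : conjq (y * z) = conjq z * conjq y.
Proof. by congr Quat => /=; ring. Qed.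
Lemma conjqK : involutive (@conjq R).
Proof. by case=> a b c d; congr Quat => /=; ring. Qed.
Lemma conjq_realq a : conjq (realq a) = realq a.
Proof. by congr Quat => /=; ring. Qed.

Lemma conjq_fixed z : conjq z = z -> exists a, z = realq a.
Proof.
have N0 (b : R) : - b = b -> b = 0.
  by move/eqP; rewrite eq_sym -addr_eq0 -mulr2n mulrn_eq0 /= => /eqP.
by case: z => a b c d [] /N0-> /N0-> /N0->; exists a.
Qed.

Lemma conjq_normP z : z != 0 -> exists2 a, 0 < a & conjq z * z = realq a.
Proof.
case: z => a b c d z0.
exists (a ^+ 2 + b ^+ 2 + c ^+ 2 + d ^+ 2); last by congr Quat => /=; ring.
rewrite lt0r !addr_ge0 ?sqr_ge0// andbT; apply: contra z0.
rewrite !paddr_eq0 ?addr_ge0 ?sqr_ge0// !sqrf_eq0.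
by move=> /andP[/andP[/andP[/eqP-> /eqP->] /eqP->] /eqP->]; apply/eqP.
Qed.

HB.instance Definition _ := @isStarDivision.Build R (quaternion R)
  (@realq R) (@conjq R) realqB erefl realqM realqC
  conjqB conjqM conjqK conjq_realq conjq_fixed conjq_normP.

End QuaternionInstance.

Variant scalar_kind := Reals | Complexes | Quaternions.

Definition scalars (R : realType) (k : scalar_kind) : starDivisionType R :=
  match k with
  | Reals => R
  | Complexes => R[i]
  | Quaternions => quaternion R
  end.

Section Matrices.
Variables (R : realType) (D : starDivisionType R).

Definition adjmx m n (A : 'M[D]_(m, n)) : 'M[D]_(n, m) :=
  \matrix_(i, j) sconj (A j i).

Definition hermitian n (A : 'M[D]_n) : Prop := A = adjmx A.

(* "x^* A x > 0" in [D]: the entry is a real scalar, and a positive one. *)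
Definition posdef n : set 'M[D]_n :=
  [set A | hermitian A /\ forall x : 'cV[D]_n, x != 0 ->
    exists2 r : R, 0 < r & (adjmx x *m A *m x) 0 0 = inR r].

Definition loewner n (A B : 'M[D]_n) : Prop :=
  hermitian (B - A) /\ forall x : 'cV[D]_n,
    exists2 r : R, 0 <= r & (adjmx x *m (B - A) *m x) 0 0 = inR r.

(* [unitmx] and [invmx] require a commutative ring. *)
Definition GLmx n : set 'M[D]_n :=
  [set g | exists h : 'M[D]_n, g *m h = 1%:M /\ h *m g = 1%:M].

Definition real_diag n (lam : 'I_n -> R) : 'M[D]_n :=
  diag_mx (\row_i inR (lam i)).

Definition spectral_decomposition n (X U : 'M[D]_n) (lam : n.-tuple R) : Prop :=
  [/\ GLmx U, U *m adjmx U = 1%:M, forall i, 0 < tnth lam i &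
      X = U *m real_diag (tnth lam) *m adjmx U].

(* [lam] lists the eigenvalues of [X], in some order, with multiplicity. *)
Definition eigenvalues n (X : 'M[D]_n) (lam : n.-tuple R) : Prop :=
  exists U, spectral_decomposition X U lam.

(* f(X) is computed from some spectral decomposition of [X] (the result does   *)
(* not depend on which); it is the junk value 0 when [X] is not in [posdef].   *)
Definition funcalc (f : R -> R) n (X : 'M[D]_n) : 'M[D]_n :=
  xget 0 [set Y | exists U (lam : n.-tuple R),
    spectral_decomposition X U lam /\
    Y = U *m real_diag (f \o tnth lam) *m adjmx U].

Definition powmx n (X : 'M[D]_n) (t : R) : 'M[D]_n :=
  funcalc (fun x => x `^ t) X.

(* A^{-1/2} B A^{-1/2} *)
Definition relmx n (A B : 'M[D]_n) : 'M[D]_n :=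
  powmx A (- 2^-1) *m B *m powmx A (- 2^-1).

(* Only the restriction of [sigma] to [posdef] matters. *)
Record kubo_ando_mean n (sigma : 'M[D]_n -> 'M[D]_n -> 'M[D]_n) : Prop := {
  ka_posdef : forall A B, posdef A -> posdef B -> posdef (sigma A B);
  ka_continuous : {within @posdef n `*` @posdef n,
    continuous (fun AB : 'M[D]_n * 'M[D]_n => sigma AB.1 AB.2)};
  ka_monotone : forall A B C E,
    posdef A -> posdef B -> posdef C -> posdef E ->
    loewner A B -> loewner C E -> loewner (sigma A C) (sigma B E);
  ka_congruence : forall g A B, GLmx g -> posdef A -> posdef B ->
    g *m sigma A B *m adjmx g =
    sigma (g *m A *m adjmx g) (g *m B *m adjmx g);
  ka_normalized : sigma 1%:M 1%:M = 1%:M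
}.

End Matrices.

Arguments posdef {R D n} _.
Arguments GLmx {R D n} _.

(* Always tested on complex matrices, whatever the scalars of the mean. *)
Definition operator_monotone (R : realType) (f : R -> R) : Prop :=
  forall (k : nat) (A B : 'M[R[i]]_k), (1 <= k)%N ->
    posdef A -> posdef B -> loewner A B -> loewner (funcalc f A) (funcalc f B).

(* [f] maps (0, +oo) to itself; its values elsewhere are irrelevant. *)
Record representing_function (R : realType) (D : starDivisionType R) n
    (sigma : 'M[D]_n -> 'M[D]_n -> 'M[D]_n) (f : R -> R) : Prop := {
  rf_pos : forall x, 0 < x -> 0 < f x;
  rf_monotone : operator_monotone f;
  rf_normalized : f 1 = 1;
  rf_represents : forall A B : 'M[D]_n, posdef A -> posdef B ->
    sigma A B = powmx A 2^-1 *m funcalc f (relmx A B) *m powmx A 2^-1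
}.

Definition alpha_coef (R : realType) (f : R -> R) (lp lm : R) : R :=
  if lp != lm then (lp * f lm - lm * f lp) / (lp - lm) else f lp.

Definition beta_coef (R : realType) (f : R -> R) (lp lm : R) : R :=
  if lp != lm then (f lp - f lm) / (lp - lm) else 0.

(* Main.v *)
Require Import Defs.
From HB Require Import structures.
From mathcomp Require Import all_boot all_order all_algebra.
From mathcomp Require Import ring.
From mathcomp Require Import all_classical reals topology normedtype exp.

Import Order.TTheory GRing.Theory Num.Theory.
Local Open Scope ring_scope.

(** Write P = A^(1/2), Q = A^(-1/2) and X = Q B Q.  A 2 x 2 positive definite
    X has at most two eigenvalues, so on its spectrum f agrees with the affine
    function alpha + beta t interpolating f at lambda_+ and lambda_-, and
    functional calculus turns this into f(X) = alpha Id + beta X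
    ([funcalc2_interpolation]).  Conjugating by P, with P P = A and
    P X P = B, gives P f(X) P = alpha A + beta B.

    Uniqueness: conjugating a relation a A + b B = a' A + b' B by Q gives
    (b - b') X = (a' - a) Id.  Either b = b', whence a = a', or X is scalar,
    with a double eigenvalue; then both b and b' vanish by the convention
    attached to that case.  Since every listing of the eigenvalues of X gives
    an expression of the mean that satisfies this convention, the same
    argument shows that the coefficients do not depend on the listing.

    What makes this available over R, C and H at once is that it only uses
    a division ring with conjugation whose real scalars are central:
    the spectral theorem for 2 x 2 Hermitian matrices ([hermitian2_diag]) is
    reduced to the real symmetric case by absorbing the phase of the
    off-diagonal entry in a diagonal unitary, and the functional calculus is
    independent of the diagonalisation ([funcalcE]), in any size. *)

(** * Scalars with conjugation *)

HB.instance Definition _ (R : realType) (D : starDivisionType R) :=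
  GRing.isZmodMorphism.Build R D (@inR R D) (@inR_is_additive R D).
HB.instance Definition _ (R : realType) (D : starDivisionType R) :=
  GRing.isMonoidMorphism.Build R D (@inR R D) (@inR1 R D, @inRM R D).
HB.instance Definition _ (R : realType) (D : starDivisionType R) :=
  GRing.isZmodMorphism.Build D D (@sconj R D) (@sconjB R D).

Section StarMatrices.
Set Implicit Arguments.
Unset Strict Implicit.
Context {R : realType} {D : starDivisionType R}.

Lemma inR_inj : injective (@inR R D).
Proof.
move=> a b /eqP; rewrite -subr_eq0 -rmorphB => /eqP ab0.
apply/eqP; rewrite -subr_eq0; apply/negP => /negP nz.
have := oner_neq0 D; rewrite -(rmorph1 (@inR R D)) -(mulfV nz) rmorphM ab0.
by rewrite mul0r eqxx.
Qed.

Lemma inR_mul_eq0 (a : R) (z : D) : inR a * z = 0 -> a != 0 -> z = 0.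
Proof.
move=> az0 a0; rewrite -[z]mul1r -(rmorph1 (@inR R D)) -(mulVf a0) rmorphM.
by rewrite -mulrA az0 mulr0.
Qed.

Lemma sconj1 : sconj (1 : D) = 1.
Proof. by rewrite -(rmorph1 (@inR R D)) sconj_inR. Qed.

(** With w the conjugate of z, both z w and w z are real, and comparing (z w) z
    with z (w z) equates them. *)
Lemma mul_sconjC (z : D) : z * sconj z = sconj z * z.
Proof.
have [->|z0] := eqVneq z 0; first by rewrite mul0r mulr0.
have [a a0 zz] := sconj_normP _ z0.
have [b zzb] : exists b, z * sconj z = inR b.
  by apply: sconj_fixed; rewrite sconjM sconjK.
rewrite zz zzb; congr inR; apply/eqP; rewrite -subr_eq0; apply: contraT => ba.
have z00 : z = 0.
  apply: inR_mul_eq0 ba; rewrite inR_is_additive mulrBl -zzb -mulrA zz -inRC.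
  by rewrite subrr.
by rewrite z00 eqxx in z0.
Qed.

(** * Adjoints and real diagonal matrices *)

Lemma adjmxK m n (A : 'M[D]_(m, n)) : adjmx (adjmx A) = A.
Proof. by apply/matrixP => i j; rewrite !mxE sconjK. Qed.

Lemma adjmxM m n p (A : 'M[D]_(m, n)) (B : 'M[D]_(n, p)) :
  adjmx (A *m B) = adjmx B *m adjmx A.
Proof.
apply/matrixP => i j; rewrite !mxE raddf_sum.
by apply: eq_bigr => k _; rewrite !mxE /= sconjM.
Qed.

Lemma adjmx1 n : adjmx (1%:M : 'M[D]_n) = 1%:M.
Proof.
apply/matrixP => i j; rewrite !mxE eq_sym.
by case: (i == j); rewrite ?sconj1 ?raddf0.
Qed.

Lemma adjmx_map m n (V : 'M[R]_(m, n)) :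
  adjmx (map_mx (@inR R D) V) = map_mx inR V^T.
Proof. by apply/matrixP => i j; rewrite !mxE sconj_inR. Qed.

(** Real scalars are central, so they pass through a left factor although
    general scalars do not. *)
Lemma mulmx_inRr m n p (A : 'M[D]_(m, n)) a (B : 'M[D]_(n, p)) :
  A *m (inR a *: B) = inR a *: (A *m B).
Proof.
apply/matrixP => i j; rewrite !mxE mulr_sumr; apply: eq_bigr => k _.
by rewrite !mxE mulrA -inRC mulrA.
Qed.

Lemma real_diagE n (l : 'I_n -> R) (i j : 'I_n) :
  real_diag D l i j = inR (l i) *+ (i == j).
Proof. by rewrite !mxE. Qed.

Lemma real_diagM n (l m : 'I_n -> R) :
  real_diag D l *m real_diag D m = real_diag D (fun i => l i * m i).
Proof.
apply/matrixP => i j; rewrite mul_diag_mx !mxE rmorphM.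
by case: (i == j); rewrite ?mulr0.
Qed.

Lemma eq_real_diag n (l m : 'I_n -> R) :
  l =1 m -> real_diag D l = real_diag D m.
Proof. by move=> lm; apply/matrixP => i j; rewrite !real_diagE lm. Qed.

Lemma adjmx_real_diag n (l : 'I_n -> R) :
  adjmx (real_diag D l) = real_diag D l.
Proof.
apply/matrixP => i j; rewrite mxE !real_diagE eq_sym.
by case: eqP => [->|_]; rewrite ?raddf0 // sconj_inR.
Qed.

Lemma real_diag_const n (a : R) :
  real_diag D (fun _ : 'I_n => a) = inR a *: 1%:M.
Proof.
apply/matrixP => i j; rewrite real_diagE !mxE.
by case: (i == j); rewrite ?mulr1 ?mulr0.
Qed.

(** Over a general ring a one-sided inverse of a matrix need not be two-sided,
    so the other identity is drawn from invertibility. *)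
Lemma unitaryC n (U : 'M[D]_n) :
  GLmx U -> U *m adjmx U = 1%:M -> adjmx U *m U = 1%:M.
Proof.
move=> [h [_ hU]] UU.
by rewrite -[adjmx U]mul1mx -hU -(mulmxA h) UU mulmx1.
Qed.

Lemma unitary_diagM n (U : 'M[D]_n) (l m : 'I_n -> R) :
  adjmx U *m U = 1%:M ->
  (U *m real_diag D l *m adjmx U) *m (U *m real_diag D m *m adjmx U) =
  U *m real_diag D (fun i => l i * m i) *m adjmx U.
Proof.
move=> UU; rewrite -real_diagM !mulmxA.
by rewrite -(mulmxA (U *m real_diag D l) (adjmx U)) UU mulmx1.
Qed.

Lemma unitary_diag_const n (U : 'M[D]_n) (a : R) :
  U *m adjmx U = 1%:M ->
  U *m real_diag D (fun=> a) *m adjmx U = inR a *: 1%:M.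
Proof. by move=> UU; rewrite real_diag_const mulmx_inRr mulmx1 -scalemxAl UU. Qed.

Lemma posdef_congruence n (g B : 'M[D]_n) :
  GLmx g -> posdef B -> posdef (g *m B *m adjmx g).
Proof.
move=> [h [gh hg]] [Bh Bp]; split.
  by rewrite /Defs.hermitian !adjmxM adjmxK -Bh mulmxA.
move=> x x0; have [|r r0 Br] := Bp (adjmx g *m x).
  apply: contra x0 => /eqP gx0.
  by rewrite -[x]mul1mx -adjmx1 -gh adjmxM -mulmxA gx0 mulmx0.
by exists r; rewrite // -Br adjmxM adjmxK !mulmxA.
Qed.

Lemma posdef_real_diag n (l : 'I_n -> R) i : posdef (real_diag D l) -> 0 < l i.
Proof.
move=> [_ lp]; pose e : 'cV[D]_n := delta_mx i 0.
have [|r r0] := lp e.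
  by apply/eqP => /matrixP/(_ i 0)/eqP; rewrite !mxE !eqxx oner_eq0.
have -> : adjmx e = delta_mx 0 i.
  apply/matrixP => a b; rewrite !mxE andbC.
  by case: (_ && _); rewrite ?sconj1 ?raddf0.
by rewrite -rowE -colE !mxE eqxx => /inR_inj->.
Qed.

(** * Functional calculus *)

(** The hypothesis says that W i j vanishes unless l j = m i, and where
    l j = m i also f (l j) = f (m i). *)
Lemma diag_intertwining (f : R -> R) n (W : 'M[D]_n) (l m : 'I_n -> R) :
  W *m real_diag D l = real_diag D m *m W ->
  W *m real_diag D (f \o l) = real_diag D (f \o m) *m W.
Proof.
move=> WE; apply/matrixP => i j; move/matrixP/(_ i j): WE.
rewrite !mul_diag_mx !mul_mx_diag !mxE -!inRC /= => Wij.
have [->//|lm] := eqVneq (l j) (m i).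
suff -> : W i j = 0 by rewrite !mulr0.
apply: (@inR_mul_eq0 (l j - m i)); last by rewrite subr_eq0.
by rewrite inR_is_additive mulrBl Wij subrr.
Qed.

(** Two diagonalisations by U and V differ by the change of basis W = V^* U,
    which intertwines the two lists of eigenvalues, hence their images by f. *)
Lemma funcalcE (f : R -> R) n (X U : 'M[D]_n) (lam : n.-tuple R) :
  spectral_decomposition X U lam ->
  funcalc f X = U *m real_diag D (f \o tnth lam) *m adjmx U.
Proof.
move=> XUl; have [GU UU _ XU] := XUl.
apply: xget_unique; first by exists U, lam.
move=> _ [V [mu [[GV VV _ XV] ->]]].
have U1 := unitaryC GU UU; have V1 := unitaryC GV VV.
have interW : (adjmx V *m U) *m real_diag D (tnth lam) =
              real_diag D (tnth mu) *m (adjmx V *m U).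
  rewrite -[LHS]mulmx1 -U1 !mulmxA -!(mulmxA (adjmx V)) -XU XV.
  by rewrite !mulmxA V1 mul1mx.
set W := adjmx V *m U in interW.
have interfW : W *m real_diag D (f \o tnth lam) =
               real_diag D (f \o tnth mu) *m W.
  exact: diag_intertwining.
have WW : W *m adjmx W = 1%:M.
  by rewrite adjmxM adjmxK !mulmxA -(mulmxA _ U) UU mulmx1.
have -> : U = V *m W by rewrite mulmxA VV mul1mx.
clearbody W.
rewrite adjmxM -(mulmxA V W) interfW !mulmxA -(mulmxA _ W (adjmx W)).
by rewrite WW mulmx1.
Qed.

Lemma powmx_mul n (X U : 'M[D]_n) (lam : n.-tuple R) (s t : R) :
  spectral_decomposition X U lam ->
  powmx X s *m powmx X t = powmx X (s + t).
Proof.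
move=> XUl; have [GU UU lpos _] := XUl.
rewrite /powmx !(funcalcE _ XUl) (unitary_diagM _ _ (unitaryC GU UU)).
congr (_ *m _ *m _); apply: eq_real_diag => i /=.
by rewrite powRD // (gt_eqF (lpos i)) implybT.
Qed.

Lemma powmx0 n (X U : 'M[D]_n) (lam : n.-tuple R) :
  spectral_decomposition X U lam -> powmx X 0 = 1%:M.
Proof.
move=> XUl; have [_ UU _ _] := XUl.
rewrite /powmx (funcalcE _ XUl) (@eq_real_diag _ _ (fun=> 1)).
  by rewrite unitary_diag_const // rmorph1 scale1r.
by move=> i /=; rewrite powRr0.
Qed.

Lemma powmx1 n (X U : 'M[D]_n) (lam : n.-tuple R) :
  spectral_decomposition X U lam -> powmx X 1 = X.
Proof.
move=> XUl; have [_ _ lpos XU] := XUl.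
rewrite /powmx (funcalcE _ XUl) [RHS]XU; congr (_ *m _ *m _).
by apply: eq_real_diag => i /=; rewrite powRr1 // ltW.
Qed.

Lemma adjmx_powmx n (X U : 'M[D]_n) (lam : n.-tuple R) (t : R) :
  spectral_decomposition X U lam -> adjmx (powmx X t) = powmx X t.
Proof.
move=> XUl.
by rewrite /powmx (funcalcE _ XUl) !adjmxM adjmxK adjmx_real_diag mulmxA.
Qed.

(** * The spectral theorem in size two *)

Lemma polar (z : D) : exists (u : D) (r : R),
  [/\ z = u * inR r, u * sconj u = 1 & sconj u * u = 1].
Proof.
have [->|z0] := eqVneq z 0.
  by exists 1, 0; split; rewrite ?rmorph0 ?sconj1 ?mulr0 ?mulr1.
have [a a0 zz] := sconj_normP _ z0.
have sa0 : Num.sqrt a != 0 by rewrite gt_eqF // sqrtr_gt0.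
have uu : sconj (z * inR (Num.sqrt a)^-1) * (z * inR (Num.sqrt a)^-1) = 1.
  rewrite sconjM sconj_inR mulrA -(mulrA _ (sconj z)) zz -!rmorphM.
  by rewrite mulrAC -invfM -expr2 sqr_sqrtr ?ltW // mulVf ?gt_eqF // rmorph1.
exists (z * inR (Num.sqrt a)^-1), (Num.sqrt a); split=> //.
  by rewrite -mulrA -rmorphM mulVf // rmorph1 mulr1.
by rewrite mul_sconjC.
Qed.

End StarMatrices.

Lemma ord2P (i : 'I_2) : i = 0 \/ i = 1.
Proof. by case: i => [[|[|//]] lti]; [left|right]; apply/val_inj. Qed.

Lemma matrix2P (T : Type) (A B : 'M[T]_2) :
  A 0 0 = B 0 0 -> A 0 1 = B 0 1 -> A 1 0 = B 1 0 -> A 1 1 = B 1 1 -> A = B.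
Proof.
by move=> ? ? ? ?; apply/matrixP => i j; case: (ord2P i) => ->;
  case: (ord2P j) => ->.
Qed.

Lemma sum2E (V : nmodType) (F : 'I_2 -> V) : \sum_(i < 2) F i = F 0 + F 1.
Proof.
rewrite !big_ord_recl big_ord0 addr0; congr (_ + F _).
exact/val_inj.
Qed.

Section TwoByTwo.
Set Implicit Arguments.
Unset Strict Implicit.
Context {R : realType} {D : starDivisionType R}.

(** The rotation by an angle theta, with c = cos theta and s = sin theta,
    diagonalises the real symmetric matrix with off-diagonal entry r and
    diagonal difference d exactly when this equation holds; for r != 0 it is
    a quadratic equation of positive discriminant in t = s / c. *)
Lemma jacobi_rotation (d r : R) : exists c s : R,
  c ^+ 2 + s ^+ 2 = 1 /\ (c ^+ 2 - s ^+ 2) * r = c * s * d.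
Proof.
have [->|r0] := eqVneq r 0.
  by exists 1, 0; rewrite expr1n expr0n /= addr0 !mulr0 mul0r.
pose t := (- d + Num.sqrt (d ^+ 2 + 4 * r ^+ 2)) / (2 * r).
have ht : (1 - t ^+ 2) * r = t * d.
  have D0 : 0 <= d ^+ 2 + 4 * r ^+ 2.
    by rewrite addr_ge0 ?sqr_ge0 // mulr_ge0 ?sqr_ge0.
  have e : (1 - t ^+ 2) * r - t * d =
    (d ^+ 2 + 4 * r ^+ 2 - Num.sqrt (d ^+ 2 + 4 * r ^+ 2) ^+ 2) / (4 * r).
    by rewrite /t; field.
  by apply/eqP; rewrite -subr_eq0 e sqr_sqrtr // subrr mul0r.
clearbody t.
have t0 : 0 < 1 + t ^+ 2 by rewrite ltr_pwDl ?sqr_ge0.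
pose w := (Num.sqrt (1 + t ^+ 2))^-1.
have w2 : w ^+ 2 = (1 + t ^+ 2)^-1 by rewrite exprVn sqr_sqrtr // ltW.
exists w, (t * w); split.
  by rewrite exprMn w2; field; rewrite gt_eqF.
transitivity (w ^+ 2 * ((1 - t ^+ 2) * r)); first by ring.
by rewrite ht; ring.
Qed.

Lemma real_symmetric2_diag (S : 'M[R]_2) : S 1 0 = S 0 1 ->
  exists (V : 'M[R]_2) (l : 'I_2 -> R),
    V *m V^T = 1%:M /\ S = V *m diag_mx (\row_i l i) *m V^T.
Proof.
move=> S10.
have [c [s [cs1 cs]]] := jacobi_rotation (S 0 0 - S 1 1) (S 0 1).
pose V : 'M[R]_2 := \matrix_(i, j)
  (if i == 0 then if j == 0 then c else - s else if j == 0 then s else c).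
have VV : V *m V^T = 1%:M.
  apply: matrix2P; rewrite !mxE sum2E !mxE /= -?cs1; ring.
pose T := V^T *m S *m V.
exists V, (fun i => T i i); split=> //.
have T01 : T 0 1 = 0.
  transitivity ((c ^+ 2 - s ^+ 2) * S 0 1 - c * s * (S 0 0 - S 1 1)).
    by rewrite !(mxE, sum2E) /= S10; ring.
  by rewrite cs subrr.
have T10 : T 1 0 = 0.
  by rewrite -T01 !(mxE, sum2E) /= S10; ring.
have -> : diag_mx (\row_i T i i) = T.
  by clearbody T; apply: matrix2P; rewrite ?T01 ?T10 !mxE.
by rewrite /T !mulmxA VV mul1mx -mulmxA VV mulmx1.
Qed.

(** The diagonal of a Hermitian matrix is real; conjugating by diag(u, 1), with
    u the phase of the off-diagonal entry, makes the whole matrix real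
    symmetric, and a real rotation then diagonalises it. *)
Lemma hermitian2_diag (X : 'M[D]_2) : Defs.hermitian X ->
  exists (U : 'M[D]_2) (l : 'I_2 -> R),
    [/\ U *m adjmx U = 1%:M, adjmx U *m U = 1%:M &
        X = U *m real_diag D l *m adjmx U].
Proof.
move=> Xh.
have Xij i j : sconj (X i j) = X j i by rewrite {2}Xh mxE.
have [p X00] := sconj_fixed _ (Xij 0 0).
have [q X11] := sconj_fixed _ (Xij 1 1).
have [u [r [X01 uu uu']]] := polar (X 0 1).
pose S : 'M[R]_2 := \matrix_(i, j)
  (if i == j then if i == 0 then p else q else r).
have [|V [l [VV SV]]] := @real_symmetric2_diag S; first by rewrite !mxE.
pose T : 'M[D]_2 := diag_mx (\row_i (if i == 0 then u else 1)).
have adjT : adjmx T = diag_mx (\row_i (if i == 0 then sconj u else 1)).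
  by apply: matrix2P; rewrite !mxE /= ?raddf0 ?sconj1.
have TT : T *m adjmx T = 1%:M.
  by apply: matrix2P; rewrite adjT mul_diag_mx !mxE /= ?mulr0 ?mulr1.
have TT' : adjmx T *m T = 1%:M.
  by apply: matrix2P; rewrite adjT mul_diag_mx !mxE /= ?mulr0 ?mulr1.
have XT : X = T *m map_mx inR S *m adjmx T.
  apply: matrix2P; rewrite adjT mul_mx_diag mul_diag_mx !mxE /= ?mulr1 ?mul1r //.
  - by rewrite -inRC -mulrA uu mulr1.
  - by rewrite -(Xij 0 1) X01 sconjM sconj_inR.
have VV' : V^T *m V = 1%:M by apply: mulmx1C.
exists (T *m map_mx inR V), l; rewrite adjmxM adjmx_map; split.
- by rewrite mulmxA -(mulmxA T) -map_mxM VV map_mx1 mulmx1.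
- by rewrite mulmxA -(mulmxA _ (adjmx T)) TT' mulmx1 -map_mxM VV' map_mx1.
rewrite {1}XT SV !map_mxM !mulmxA; congr (_ *m _ *m _ *m _).
by apply/matrixP => i j; rewrite !mxE raddfMn.
Qed.

Lemma posdef2_eigenvalues (X : 'M[D]_2) : posdef X ->
  exists lp lm, eigenvalues X [tuple lp; lm].
Proof.
move=> Xp; have [U [l [UU UU' XU]]] := hermitian2_diag (proj1 Xp).
have lE : tnth [tuple l 0; l 1] =1 l.
  by move=> i; case: (ord2P i) => ->.
exists (l 0), (l 1), U; split=> //.
- by exists (adjmx U).
- move=> i; rewrite lE; apply: (@posdef_real_diag _ D).
  suff -> : real_diag D l = adjmx U *m X *m adjmx (adjmx U).
    by apply: posdef_congruence => //; exists U.
  by rewrite XU adjmxK !mulmxA UU' mul1mx -mulmxA UU' mulmx1.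
by rewrite XU (eq_real_diag lE).
Qed.

(** * Interpolation and the mean *)

Lemma lagrange_coef (f : R -> R) (lp lm : R) :
  alpha_coef f lp lm + beta_coef f lp lm * lp = f lp /\
  alpha_coef f lp lm + beta_coef f lp lm * lm = f lm.
Proof.
rewrite /alpha_coef /beta_coef; have [->|lpm] /= := eqVneq lp lm.
  by rewrite !mul0r addr0.
by split; field; rewrite subr_eq0.
Qed.

(** On a spectrum of at most two points every function is affine, and the
    functional calculus of an affine function is the obvious one. *)
Lemma funcalc2_interpolation (f : R -> R) (X : 'M[D]_2) (lp lm : R) :
  eigenvalues X [tuple lp; lm] ->
  funcalc f X = inR (alpha_coef f lp lm) *: 1%:M + inR (beta_coef f lp lm) *: X.
Proof.
move=> [U XUl]; have [_ UU _ XU] := XUl.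
have [fp fm] := lagrange_coef f lp lm.
have fl : real_diag D (f \o tnth [tuple lp; lm]) =
  inR (alpha_coef f lp lm) *: 1%:M +
  inR (beta_coef f lp lm) *: real_diag D (tnth [tuple lp; lm]).
  apply: matrix2P; rewrite !mxE /= ?mulr0 ?addr0 // mulr1 -rmorphM -rmorphD.
  - by rewrite -[in LHS]fp.
  - by rewrite -[in LHS]fm.
rewrite (funcalcE _ XUl) fl mulmxDr mulmxDl !mulmx_inRr -!scalemxAl.
by rewrite mulmx1 UU -XU.
Qed.

Lemma eigenvalues_scalar (c : R) :
  posdef (inR c *: 1%:M : 'M[D]_2) ->
  eigenvalues (inR c *: 1%:M : 'M[D]_2) [tuple c; c].
Proof.
have cE : tnth [tuple c; c] =1 fun=> c by move=> i; case: (ord2P i) => ->.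
rewrite -real_diag_const => cp; exists 1%:M; split.
- by exists 1%:M; rewrite mulmx1.
- by rewrite adjmx1 mulmx1.
- by move=> i; rewrite cE; apply: posdef_real_diag i cp.
- by rewrite adjmx1 mulmx1 mul1mx (eq_real_diag cE).
Qed.

(** A double eigenvalue makes X a scalar matrix, which leaves no room for another
    diagonalisation with distinct entries. *)
Lemma scalar_eigenvalues (X : 'M[D]_2) (lp lm l : R) :
  eigenvalues X [tuple l; l] -> eigenvalues X [tuple lp; lm] -> lp = lm.
Proof.
have lE : tnth [tuple l; l] =1 fun=> l by move=> i; case: (ord2P i) => ->.
move=> [V [_ VV _]]; rewrite (eq_real_diag lE) unitary_diag_const // => Xl.
move=> [U [GU UU _]]; rewrite Xl => XU.
have : real_diag D (tnth [tuple lp; lm]) = inR l *: 1%:M.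
  have U1 := unitaryC GU UU.
  transitivity (adjmx U *m
      (U *m real_diag D (tnth [tuple lp; lm]) *m adjmx U) *m U).
    by rewrite !mulmxA U1 mul1mx -mulmxA U1 mulmx1.
  by rewrite -XU mulmx_inRr mulmx1 -scalemxAl U1.
move=> E; have := congr1 (fun M : 'M_2 => M 0 0) E.
have := congr1 (fun M : 'M_2 => M 1 1) E.
rewrite !mxE mulr1 => /inR_inj lmE /inR_inj lpE.
exact: etrans lpE (esym lmE).
Qed.

(** Both uniqueness and the independence of the coefficients from the listing of
    the eigenvalues come from one fact, [uniq] in the proof: two expressions of
    a matrix as a real combination of A and B agree once both obey the convention
    for a double eigenvalue. *)
Lemma kubo_ando_linear (sigma : 'M[D]_2 -> 'M[D]_2 -> 'M[D]_2) (f : R -> R)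
  (hf : representing_function sigma f)
  (A B : 'M[D]_2) (hA : posdef A) (hB : posdef B) :
  exists alpha beta : R,
    [/\ sigma A B = inR alpha *: A + inR beta *: B,
        forall a b : R, sigma A B = inR a *: A + inR b *: B ->
          (forall l : R, eigenvalues (relmx A B) [tuple l; l] -> b = 0) ->
          a = alpha /\ b = beta &
        forall lp lm : R, eigenvalues (relmx A B) [tuple lp; lm] ->
          alpha = alpha_coef f lp lm /\ beta = beta_coef f lp lm].
Proof.
have [lA [mA [UA Asp]]] := posdef2_eigenvalues hA.
set X := relmx A B.
pose P := powmx A 2^-1; pose Q := powmx A (- 2^-1).
have PP : P *m P = A.
  rewrite (powmx_mul _ _ Asp) -[RHS](powmx1 Asp); congr powmx.
  by rewrite [RHS]splitr mul1r.
have PQ : P *m Q = 1%:M by rewrite (powmx_mul _ _ Asp) subrr (powmx0 Asp).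
have QP : Q *m P = 1%:M by rewrite (powmx_mul _ _ Asp) addNr (powmx0 Asp).
have XE : X = Q *m B *m Q by [].
have Xp : posdef X.
  have -> : X = Q *m B *m adjmx Q by rewrite (adjmx_powmx _ Asp).
  by apply: posdef_congruence => //; exists P.
have QAQ : Q *m A *m Q = 1%:M by rewrite -PP mulmxA QP mul1mx PQ.
have PXP : P *m X *m P = B.
  by rewrite XE !mulmxA PQ mul1mx -mulmxA QP mulmx1.
have lin lp lm : eigenvalues X [tuple lp; lm] -> sigma A B =
    inR (alpha_coef f lp lm) *: A + inR (beta_coef f lp lm) *: B.
  move=> /(funcalc2_interpolation f) fX.
  rewrite (rf_represents hf hA hB) -/X -/P fX mulmxDr mulmxDl !mulmx_inRr.
  by rewrite -!scalemxAl mulmx1 PP PXP.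
have beta0 lp lm : eigenvalues X [tuple lp; lm] ->
    forall l, eigenvalues X [tuple l; l] -> beta_coef f lp lm = 0.
  by move=> Xlpm l Xl; rewrite /beta_coef (scalar_eigenvalues Xl Xlpm) eqxx.
have uniq a b a' b' :
    inR a *: A + inR b *: B = inR a' *: A + inR b' *: B ->
    (forall l, eigenvalues X [tuple l; l] -> b = 0) ->
    (forall l, eigenvalues X [tuple l; l] -> b' = 0) -> a = a' /\ b = b'.
  move=> E b0 b'0.
  have {}E : inR a *: 1%:M + inR b *: X = inR a' *: 1%:M + inR b' *: X.
    have := congr1 (fun M => Q *m M *m Q) E.
    by rewrite !mulmxDr !mulmxDl !mulmx_inRr -!scalemxAl QAQ -XE.
  have {}E : inR (b - b') *: X = inR (a' - a) *: 1%:M.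
    rewrite !inR_is_additive !scalerBl.
    apply/eqP; rewrite subr_eq addrAC -E.
    by rewrite (addrC (inR a *: 1%:M)) addrK.
  (* Otherwise X would be scalar, and then b = 0 = b' by assumption. *)
  have bb : b = b'.
    apply/eqP; rewrite -subr_eq0; apply: contraT => bb.
    pose c := (b - b')^-1 * (a' - a).
    have Xc : X = inR c *: 1%:M.
      by rewrite inRM -scalerA -E scalerA -inRM mulVf // inR1 scale1r.
    have Xl : eigenvalues X [tuple c; c].
      by rewrite Xc; apply: eigenvalues_scalar; rewrite -Xc.
    by rewrite (b0 _ Xl) (b'0 _ Xl) subrr eqxx in bb.
  split=> //; apply/esym/eqP; rewrite -subr_eq0; apply/eqP/(@inR_inj _ D).
  move/matrixP/(_ 0 0): E; rewrite bb subrr !mxE mulr1 => <-.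
  by rewrite !rmorph0 mul0r.
have [lp [lm Xlpm]] := posdef2_eigenvalues Xp.
exists (alpha_coef f lp lm), (beta_coef f lp lm); split.
- exact: lin.
- by move=> a b sE b0; apply: uniq b0 (beta0 _ _ Xlpm); rewrite -sE; apply: lin.
- move=> lp' lm' Xlpm'; apply: uniq (beta0 _ _ Xlpm) (beta0 _ _ Xlpm').
  by rewrite -!lin.
Qed.

End TwoByTwo.

(* When the two eigenvalues of X coincide, A and B are proportional and the
   pair (alpha, beta) is unique only subject to beta = 0. *)
Theorem theorem5p2 (R : realType) (k : scalar_kind)
  (sigma : 'M[scalars R k]_2 -> 'M[scalars R k]_2 -> 'M[scalars R k]_2)
  (f : R -> R)
  (hsigma : kubo_ando_mean sigma) (hf : representing_function sigma f)
  (A B : 'M[scalars R k]_2) (hA : posdef A) (hB : posdef B) :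
  exists alpha beta : R,
    [/\ sigma A B = inR alpha *: A + inR beta *: B,
        forall a b : R, sigma A B = inR a *: A + inR b *: B ->
          (forall l : R, eigenvalues (relmx A B) [tuple l; l] -> b = 0) ->
          a = alpha /\ b = beta &
        forall lp lm : R, eigenvalues (relmx A B) [tuple lp; lm] ->
          alpha = alpha_coef f lp lm /\ beta = beta_coef f lp lm].
Proof. exact: kubo_ando_linear. Qed.
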